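(* Let $R$ be a (not necessarily reduced) Noetherian commutative ring of prime characteristic $p>0$ and $\mathcal{C}$ an $R$-Cartier algebra acting on $R$ (i.e. $R$ is a left $\mathcal{C}$-module, compatibly with its $R$-module structure). Let $R_{red}$ be the reduced quotient of $R$ and $\mathcal{C}_{red}=\mathcal{C}\otimes_R R_{red}$. Then the test ideal $\tau(R,\mathcal{C})$ is equal to the test module $\tau(\underline{R}_{\mathcal{C}},\mathcal{C}_{red})$ of the pair $(\underline{R}_{\mathcal{C}},\mathcal{C}_{red})$ over $R_{red}$, via the natural inclusions $\tau(\underline{R}_{\mathcal{C}},\mathcal{C}_{red})\subseteq\underline{R}_{\mathcal{C}}\subseteq R$ (whenever these test modules exist).
   Context: $R$-Cartier algebra: an $\mathbb{N}$-graded (generally non-commutative) ring $\mathcal{C}=\bigoplus_{e\ge 0}\mathcal{C}_e$ with a ring homomorphism $R\to\mathcal{C}$ whose image is $\mathcal{C}_0$, such that $r\cdot\phi=\phi\cdot r^{p^e}$ for all $r\in R$, $\phi\in\mathcal{C}_e$. For an ideal $I\subseteq R$, $\mathcal{C}I$ is a two-sided ideal and $\mathcal{C}\otimes_RR/I=\mathcal{C}/\mathcal{C}I$ is an $R/I$-Cartier algebra; a $\mathcal{C}$-module killed by $I$ is the same as a $\mathcal{C}/\mathcal{C}I$-module. Every left $\mathcal{C}$-module $M$ is an $R$-module via $R\to\mathcal{C}_0$; it is coherent if finitely generated over $R$. Put $\mathcal{C}_+=\bigoplus_{e\ge1}\mathcal{C}_e$ and let $\mathcal{C}_+^nM$ be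 the $\mathcal{C}$-submodule of $M$ generated by all $\phi_1\cdots\phi_n m$ with $\phi_i\in\mathcal{C}_+$, $m\in M$. $M$ is $F$-pure if $\mathcal{C}_+M=M$. For coherent $M$ the chain $M\supseteq\mathcal{C}_+M\supseteq\mathcal{C}_+^2M\supseteq\cdots$ stabilizes, and its stable member $\underline{M}_{\mathcal{C}}$ is the largest $F$-pure $\mathcal{C}$-submodule of $M$. An $F$-pure coherent module has radical annihilator, so $\underline{R}_{\mathcal{C}}$ is an $R_{red}$-module and a $\mathcal{C}_{red}$-module. Test module: $\tau(M,\mathcal{C})$ is the smallest $\mathcal{C}$-submodule $N\subseteq M$ such that $N_\eta=(\underline{M}_{\mathcal{C}})_\eta$ for each generic point $\eta$ of an irreducible component of $\operatorname{Supp}\underline{M}_{\mathcal{C}}$. For $M=R$ it is called the test ideal. *)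

(* Defs.v *)
From HB Require Import structures.
From mathcomp Require Import all_boot all_order all_algebra.
From mathcomp Require Import all_classical topology.

Set Implicit Arguments.
Unset Strict Implicit.
Unset Printing Implicit Defensive.

Import GRing.Theory.
Local Open Scope classical_set_scope.
Local Open Scope ring_scope.
Local Open Scope quotient_scope.

Definition submodule (S : pzRingType) (M : lmodType S) (N : set M) : Prop :=
  GRing.submod_closed [in N].

Definition span (S : pzRingType) (M : lmodType S) (X : set M) : set M :=
  smallest (@submodule S M) X.

Definition noetherian (R : comNzRingType) : Prop :=
  forall I : set R^o, submodule I -> exists s : seq R^o, I = span [set` s].

Record is_graded (C : pzRingType) (deg : nat -> set C) : Prop := IsGraded {
  graded_zmod : forall e, zmod_closed [in deg e];
  graded1 : deg 0%N 1;
  gradedM : forall d e a b, deg d a -> deg e b -> deg (d + e)%N (a * b);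
  graded_span : forall c, exists n (f : nat -> C),
    (forall e, deg e (f e)) /\ c = \sum_(e < n) f e;
  graded_free : forall n (f : nat -> C), (forall e, deg e (f e)) ->
    \sum_(e < n) f e = 0 -> forall e, (e < n)%N -> f e = 0
}.

Record cartierAlgebra (R : comNzRingType) (p : nat) (chRp : p \in [pchar R]) :=
  CartierAlgebra {
  cartier_ring :> pzRingType;
  cmap : {rmorphism R -> cartier_ring};
  cdeg : nat -> set cartier_ring;
  cdeg_graded : is_graded cdeg;
  cmap_range : range cmap = cdeg 0%N;
  cmap_comm : forall e r c, cdeg e c -> cmap r * c = c * cmap (r ^+ (p ^ e))
}.
Arguments cmap {R p chRp} C : rename.
Arguments cdeg {R p chRp} C : rename.

Definition nilrad (R : comNzRingType) (x : R) : bool :=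
  `[< exists n, x ^+ n = 0 >].

Lemma nilrad_idealr (R : comNzRingType) : idealr_closed (@nilrad R).
Proof.
split; rewrite ?unfold_in.
- by apply/asboolP; exists 1%N; rewrite expr1.
- by apply/asboolP => -[n /eqP]; rewrite expr1n oner_eq0.
move=> a u v /asboolP [m um] /asboolP [n vn]; apply/asboolP; exists (m + n)%N.
rewrite exprDn big1 // => i _; have [lin|nli] := leqP n i.
  by rewrite -(subnK lin) exprD vn mulr0 mulr0 mul0rn.
have le_m : (m <= m + n - i)%N by rewrite -addnBA ?leq_addr // ltnW.
by rewrite exprMn -(subnK le_m) (exprD u) um mulr0 mulr0 mul0r mul0rn.
Qed.

HB.instance Definition _ (R : comNzRingType) :=
  isIdealr.Build R (@nilrad R) (@nilrad_idealr R).

Definition redRing (R : comNzRingType) : comNzRingType :=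
  {ideal_quot (@nilrad R : idealr R)}.

Section CartierQuotient.
Variables (R : comNzRingType) (p : nat) (chRp : p \in [pchar R]).
Variables (C : cartierAlgebra chRp) (I : idealr R).

Definition cideal : set C := [set x | exists n (c : nat -> C) (r : nat -> R),
  (forall i, r i \in I) /\ x = \sum_(i < n) c i * cmap C (r i)].

Definition cidealb (x : C) : bool := `[< cideal x >].

Lemma cidealP x : reflect (cideal x) (x \in cidealb).
Proof. exact: asboolP. Qed.

Lemma cideal0 : cideal 0.
Proof.
exists 0%N, (fun=> 0), (fun=> 0); split; last by rewrite big_ord0.
by move=> _; apply: idealr0.
Qed.

Lemma cidealMl c x : cideal x -> cideal (c * x).
Proof.
move=> [n [d [r [rI ->]]]]; exists n, (fun i => c * d i), r; split=> //.
by rewrite mulr_sumr; apply: eq_bigr => i _; rewrite mulrA.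
Qed.

Lemma cidealD x y : cideal x -> cideal y -> cideal (x + y).
Proof.
move=> [n [d [r [rI ->]]]] [m [e [s [sI ->]]]].
exists (n + m)%N, (fun i => if (i < n)%N then d i else e (i - n)%N),
  (fun i => if (i < n)%N then r i else s (i - n)%N); split.
  by move=> i; case: ifP.
rewrite big_split_ord /=; congr (_ + _); apply: eq_bigr => i _.
  by rewrite ltn_ord.
by rewrite ltnNge leq_addr /= addKn.
Qed.

Lemma cidealN x : cideal x -> cideal (- x).
Proof. by rewrite -mulN1r; apply: cidealMl. Qed.

Lemma cideal_sum n (f : 'I_n -> C) :
  (forall i, cideal (f i)) -> cideal (\sum_i f i).
Proof. by move=> h; apply: big_ind => //; [exact: cideal0 | exact: cidealD]. Qed.

Lemma cideal_map r : r \in I -> cideal (cmap C r).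
Proof.
move=> rI; exists 1%N, (fun=> 1), (fun=> r); split=> //.
by rewrite big_ord1 mul1r.
Qed.

Lemma idealrX r n : r \in I -> (0 < n)%N -> r ^+ n \in I.
Proof. by case: n => // n rI _; rewrite exprSr idealMr. Qed.

Lemma cidealMr x c : cideal x -> cideal (x * c).
Proof.
move=> [n [d [r [rI ->]]]]; rewrite mulr_suml; apply: cideal_sum => i.
have [m [f [fd ->]]] := graded_span (cdeg_graded C) c.
rewrite -mulrA mulr_sumr mulr_sumr; apply: cideal_sum => j.
rewrite (cmap_comm _ (fd j)) mulrA; apply: cidealMl; apply: cideal_map.
by apply: idealrX; rewrite ?expn_gt0 ?(prime_gt0 (pcharf_prime chRp)).
Qed.

Lemma cidealb_zmod : zmod_closed cidealb.
Proof.
split; first by apply/cidealP/cideal0.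
move=> x y /cidealP xI /cidealP yI; apply/cidealP.
by apply: cidealD => //; apply: cidealN.
Qed.

HB.instance Definition _ := GRing.isZmodClosed.Build C cidealb cidealb_zmod.

Definition cideal_zmod : zmodClosed C := Algebra.ZmodClosed.clone C cidealb _.

Definition cquot : Type := Quotient.quot cideal_zmod.
HB.instance Definition _ := GRing.Zmodule.on cquot.

Definition cpi (c : C) : cquot := \pi_(Quotient.quot cideal_zmod) c.
Definition crepr (x : cquot) : C :=
  repr (x : Quotient.quot cideal_zmod).

Lemma creprK : cancel crepr cpi.
Proof. exact: reprK. Qed.

Lemma cpi_eq x y : (cpi x = cpi y) <-> cideal (x - y).
Proof.
split.
  by move=> /eqP; rewrite /cpi -Quotient.idealrBE => /cidealP.
by move=> /cidealP h; apply/eqP; rewrite /cpi -Quotient.idealrBE.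
Qed.

Lemma cpiK x : cideal (x - crepr (cpi x)).
Proof. by apply/cpi_eq; rewrite creprK. Qed.

Lemma cpi_is_zmod_morphism : zmod_morphism cpi.
Proof. by move=> x y; rewrite /cpi !piE. Qed.

HB.instance Definition _ := GRing.isZmodMorphism.Build C cquot cpi
  cpi_is_zmod_morphism.

Definition cone : cquot := cpi 1.
Definition cmul (x y : cquot) : cquot := cpi (crepr x * crepr y).

Lemma cpiM x y : cpi (x * y) = cmul (cpi x) (cpi y).
Proof.
apply/cpi_eq; set x' := crepr _; set y' := crepr _.
have -> : x * y - x' * y' = (x - x') * y + x' * (y - y').
  by rewrite mulrBl mulrBr addrA subrK.
apply: cidealD; first by apply/cidealMr/cpiK.
by apply/cidealMl/cpiK.
Qed.

Lemma cmulA : associative cmul.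
Proof.
by move=> x y z; rewrite -[x]creprK -[y]creprK -[z]creprK -!cpiM mulrA.
Qed.

Lemma cmul1l : left_id cone cmul.
Proof. by move=> x; rewrite -[x]creprK -cpiM mul1r. Qed.

Lemma cmul1r : right_id cone cmul.
Proof. by move=> x; rewrite -[x]creprK -cpiM mulr1. Qed.

Lemma cmulDl : left_distributive cmul +%R.
Proof.
move=> x y z; rewrite -[x]creprK -[y]creprK -[z]creprK.
by rewrite -raddfD -!cpiM mulrDl raddfD.
Qed.

Lemma cmulDr : right_distributive cmul +%R.
Proof.
move=> x y z; rewrite -[x]creprK -[y]creprK -[z]creprK.
by rewrite -raddfD -!cpiM mulrDr raddfD.
Qed.

HB.instance Definition _ := GRing.Zmodule_isPzRing.Build cquot
  cmulA cmul1l cmul1r cmulDl cmulDr.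

Lemma cpi_monoid : monoid_morphism cpi.
Proof. by split=> // x y; rewrite cpiM. Qed.

HB.instance Definition _ := GRing.isMonoidMorphism.Build C cquot cpi cpi_monoid.

Lemma quot_pchar : p \in [pchar {ideal_quot I}].
Proof. exact: (rmorph_pchar (\pi_{ideal_quot I}) chRp). Qed.

Definition cquot_map (r : {ideal_quot I}) : cquot := cpi (cmap C (repr r)).

Lemma cquot_map_pi r : cquot_map (\pi r) = cpi (cmap C r).
Proof.
apply/cpi_eq; rewrite -rmorphB; apply: cideal_map.
by rewrite Quotient.idealrBE reprK.
Qed.

Lemma cquot_map_zmod : zmod_morphism cquot_map.
Proof.
move=> x y; rewrite -[x]reprK -[y]reprK -rmorphB !cquot_map_pi.
by rewrite !rmorphB.
Qed.

Lemma cquot_map_monoid : monoid_morphism cquot_map.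
Proof.
split; first by rewrite -(rmorph1 (\pi_{ideal_quot I})) cquot_map_pi !rmorph1.
move=> x y; rewrite -[x]reprK -[y]reprK -rmorphM !cquot_map_pi.
by rewrite !rmorphM.
Qed.

HB.instance Definition _ :=
  GRing.isZmodMorphism.Build {ideal_quot I} cquot cquot_map cquot_map_zmod.
HB.instance Definition _ :=
  GRing.isMonoidMorphism.Build {ideal_quot I} cquot cquot_map cquot_map_monoid.

Definition cquot_deg (e : nat) : set cquot := cpi @` cdeg C e.

Lemma cdeg0 e : cdeg C e 0.
Proof. by have [/set_mem] := graded_zmod (cdeg_graded C) e. Qed.

Lemma cdegB e x y : cdeg C e x -> cdeg C e y -> cdeg C e (x - y).
Proof.
have [_ h] := graded_zmod (cdeg_graded C) e.
by move=> /mem_set xe /mem_set ye; apply: set_mem; apply: h.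
Qed.

Lemma cdegD e x y : cdeg C e x -> cdeg C e y -> cdeg C e (x + y).
Proof.
move=> xe ye; rewrite -[y]opprK; apply: cdegB => //.
by rewrite -[- y]add0r; apply: cdegB => //; apply: cdeg0.
Qed.

Lemma cdeg_sum e n (f : 'I_n -> C) :
  (forall i, cdeg C e (f i)) -> cdeg C e (\sum_i f i).
Proof. by move=> h; apply: big_ind => //; [exact: cdeg0 | exact: cdegD]. Qed.

Lemma cdegMmap e c r : cdeg C e c -> cdeg C e (c * cmap C r).
Proof.
move=> ce; rewrite -[e]addn0; apply: (gradedM (cdeg_graded C)) => //.
by rewrite -cmap_range; exists r.
Qed.

Lemma cdeg_span_trunc c : exists f : nat -> C, exists n,
  (forall e, cdeg C e (f e)) /\
  (forall m, (n <= m)%N -> c = \sum_(e < m) f e).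
Proof.
have [n [f [fd ->]]] := graded_span (cdeg_graded C) c.
exists (fun e => if (e < n)%N then f e else 0), n; split.
  by move=> e; case: ifP => // _; apply: cdeg0.
move=> m le_nm; rewrite -(big_mkord xpredT (fun e => if (e < n)%N then f e else 0)).
rewrite (big_cat_nat _ le_nm) //= [X in _ + X]big_nat_cond [X in _ + X]big1 ?addr0; last first.
  by move=> i /andP[/andP[]]; rewrite leqNgt => /negbTE ->.
by rewrite big_mkord; apply: eq_bigr => i _; rewrite ltn_ord.
Qed.

Lemma cideal_homog c : cideal c -> exists f : nat -> C, exists n,
  [/\ forall e, cdeg C e (f e), forall e, cideal (f e) &
      forall m, (n <= m)%N -> c = \sum_(e < m) f e].
Proof.
move=> [n [d [r [rI ->]]]].
have /choice[g gP] := fun i => cdeg_span_trunc (d i).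
have /choice[N NP] := gP.
exists (fun e => \sum_(i < n) g i e * cmap C (r i)), (\max_(i < n) N i)%N.
split.
- by move=> e; apply: cdeg_sum => i; apply: cdegMmap; apply: (NP i).1.
- by move=> e; apply: cideal_sum => i; apply: cidealMl; apply: cideal_map.
move=> m le_m; rewrite exchange_big /=; apply: eq_bigr => i _.
rewrite -mulr_suml; congr (_ * _); apply: (NP i).2.
by apply: leq_trans le_m; apply: (leq_bigmax i).
Qed.

Lemma cquot_graded : is_graded cquot_deg.
Proof.
split.
- move=> e; split; first by apply: mem_set; exists 0; [exact: cdeg0 | rewrite raddf0].
  move=> _ _ /set_mem[x xe <-] /set_mem[y ye <-]; apply: mem_set.
  by exists (x - y); [exact: cdegB | rewrite raddfB].
- by exists 1; [exact: graded1 (cdeg_graded C) | rewrite rmorph1].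
- move=> d e _ _ [x xd <-] [y ye <-]; exists (x * y); last by rewrite rmorphM.
  exact: (gradedM (cdeg_graded C)).
- move=> c; have [n [f [fd cE]]] := graded_span (cdeg_graded C) (crepr c).
  exists n, (cpi \o f); split; first by move=> e; exists (f e).
  by rewrite -[c]creprK cE raddf_sum.
move=> n f fd fs0 e lt_en.
have /choice[g gP] : forall i, exists x, cdeg C i x /\ cpi x = f i.
  by move=> i; have [x xi <-] := fd i; exists x.
pose g' i := if (i < n)%N then g i else 0.
have g'd i : cdeg C i (g' i).
  by rewrite /g'; case: ifP => _; [apply: (gP i).1 | apply: cdeg0].
have g's m : (n <= m)%N -> \sum_(i < m) g' i = \sum_(i < n) g i.
  move=> le_nm; rewrite -(big_mkord xpredT g') (big_cat_nat _ le_nm) //=.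
  rewrite [X in _ + X]big_nat_cond [X in _ + X]big1 ?addr0; last first.
    by move=> i /andP[/andP[]]; rewrite leqNgt /g' => /negbTE ->.
  by rewrite big_mkord; apply: eq_bigr => i _; rewrite /g' ltn_ord.
have : cideal (\sum_(i < n) g i).
  rewrite -[\sum_i _]subr0; apply/cpi_eq; rewrite raddf0 -fs0 raddf_sum.
  by apply: eq_bigr => i _; case: (gP i).
move=> /cideal_homog[h [N [hd hI hs]]].
pose m := maxn n N.
have gh0 : \sum_(i < m) (g' i - h i) = 0.
  by rewrite sumrB g's ?leq_maxl // (hs m) ?leq_maxr // subrr.
have /(_ e) := graded_free (cdeg_graded C) (fun i => cdegB (g'd i) (hd i)) gh0.
rewrite (leq_trans lt_en (leq_maxl _ _)) => /(_ isT)/eqP.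
rewrite subr_eq0 /g' lt_en => /eqP geh.
have [_ <-] := gP e; rewrite geh -(raddf0 cpi).
by apply/cpi_eq; rewrite subr0.
Qed.

Lemma cquot_map_range : range cquot_map = cquot_deg 0%N.
Proof.
rewrite /cquot_deg -cmap_range; apply/seteqP; split.
  by move=> _ [r _ <-]; exists (cmap C (repr r)) => //; exists (repr r).
by move=> _ [_ [r _ <-] <-]; exists (\pi r) => //; rewrite cquot_map_pi.
Qed.

Lemma cquot_map_comm e r c :
  cquot_deg e c -> cquot_map r * c = c * cquot_map (r ^+ (p ^ e)).
Proof.
move=> [x xe <-]; rewrite -[r]reprK -rmorphXn !cquot_map_pi -!rmorphM.
by rewrite (cmap_comm _ xe).
Qed.

(* C / C I, that is C tensored over R with R / I *)
Definition cartier_quot : cartierAlgebra quot_pchar :=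
  @CartierAlgebra _ _ quot_pchar cquot cquot_map _
    cquot_graded cquot_map_range cquot_map_comm.

(* A C-module killed by I, as a module over C / C I. *)
Definition killed (M : lmodType C) : Prop :=
  forall r (m : M), r \in I -> cmap C r *: m = 0.

Definition killed_mod (M : lmodType C) (IM0 : killed M) : Type := M.

Section KilledModule.
Variables (M : lmodType C) (IM0 : killed M).

HB.instance Definition _ := GRing.Zmodule.on (killed_mod IM0).

Definition killed_scale (c : cartier_quot) (m : killed_mod IM0) :
  killed_mod IM0 := crepr c *: (m : M).

Lemma cidealZ c (m : M) : cideal c -> c *: m = 0.
Proof.
move=> [n [d [r [rI ->]]]]; rewrite scaler_suml big1 // => i _.
by rewrite -scalerA IM0 // scaler0.
Qed.

Lemma killed_scale_pi c (m : M) : killed_scale (cpi c) m = c *: m.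
Proof.
apply/esym/eqP; rewrite -subr_eq0 -scalerBl; apply/eqP.
by apply: cidealZ; apply: cpiK.
Qed.

Lemma killed_scaleA a b m :
  killed_scale a (killed_scale b m) = killed_scale (a * b) m.
Proof.
rewrite -[a]creprK -[b]creprK -(rmorphM cpi) !killed_scale_pi.
by rewrite scalerA.
Qed.

Lemma killed_scale1 : left_id 1 killed_scale.
Proof. by move=> m; rewrite -(rmorph1 cpi) killed_scale_pi scale1r. Qed.

Lemma killed_scaleDr : right_distributive killed_scale +%R.
Proof. by move=> c m m'; rewrite /killed_scale scalerDr. Qed.

Lemma killed_scaleDl m : {morph killed_scale^~ m : a b / a + b}.
Proof.
move=> a b; rewrite -[a]creprK -[b]creprK -raddfD !killed_scale_pi.
by rewrite scalerDl.
Qed.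

HB.instance Definition _ := GRing.Zmodule_isLmodule.Build cartier_quot
  (killed_mod IM0) killed_scaleA killed_scale1 killed_scaleDr killed_scaleDl.
End KilledModule.

End CartierQuotient.

Section FPurePart.
Variables (R : comNzRingType) (p : nat) (chRp : p \in [pchar R]).
Variables (C : cartierAlgebra chRp) (M : lmodType C).

Definition cplus : set C := [set c | exists n (f : nat -> C),
  (forall e, cdeg C e.+1 (f e)) /\ c = \sum_(e < n) f e].

Definition cplus_pow (n : nat) : set M := span [set x | exists (c : 'I_n -> C) m,
  (forall i, cplus (c i)) /\ x = (\prod_(i < n) c i) *: m].

(* The stable member of the chain: what belongs to cplus_pow n for all large n.
   When the chain is constant from n0 on, this is cplus_pow n0 (fpartE). *)
Definition fpart : set M := [set x | \forall n \near \oo, cplus_pow n x].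

Lemma submodule_span (X : set M) : submodule (span X).
Proof.
split; first by apply: mem_set => N [[/set_mem ? _]].
move=> a u v /set_mem uX /set_mem vX; apply: mem_set => N [Nsub XN].
have [_ h] := Nsub; apply: set_mem; apply: h; apply: mem_set.
  exact: uX.
exact: vX.
Qed.

Lemma submodule_fpart : submodule fpart.
Proof.
have [h0 hD] : (forall n, cplus_pow n 0) /\
    (forall n a u v, cplus_pow n u -> cplus_pow n v -> cplus_pow n (a *: u + v)).
  split=> [n|n a u v un vn].
    by have [/set_mem] := submodule_span [set x | exists (c : 'I_n -> C) m,
      (forall i, cplus (c i)) /\ x = (\prod_(i < n) c i) *: m].
  have [_ h] := submodule_span [set x | exists (c : 'I_n -> C) m,
      (forall i, cplus (c i)) /\ x = (\prod_(i < n) c i) *: m].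
  by apply: set_mem; apply: h; apply: mem_set.
split; first by apply: mem_set; apply: nearW.
move=> a u v /set_mem uf /set_mem vf; apply: mem_set.
by apply: filterS2 uf vf => n; apply: hD.
Qed.

Lemma fpartE n0 : (forall n, (n0 <= n)%N -> cplus_pow n = cplus_pow n0) ->
  fpart = cplus_pow n0.
Proof.
move=> st; apply/seteqP; split=> [x [N _ xN]|x xn0].
  rewrite -(st (maxn n0 N)) ?leq_maxl //; apply: xN; exact: leq_maxr.
by exists n0 => // n /= le_n; rewrite st.
Qed.

Lemma cplus_nil n r (c : 'I_n -> C) : r ^+ (p ^ n) = 0 ->
  (forall i, cplus (c i)) -> cmap C r * \prod_(i < n) c i = 0.
Proof.
elim: n r c => [|n IHn] r c rn0 c_plus.
  by move: rn0; rewrite expn0 expr1 => ->; rewrite rmorph0 mul0r.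
rewrite big_ord_recl mulrA; have [m [f [fd ->]]] := c_plus ord0.
rewrite mulr_sumr mulr_suml big1 // => e _.
rewrite (cmap_comm _ (fd e)) -mulrA IHn ?mulr0 //.
by rewrite -exprM -expnD addSnnS addnC expnD exprM rn0 expr0n expn_eq0
  -leqn0 leqNgt prime_gt0 // (pcharf_prime chRp).
Qed.

Lemma submodule_killed r : submodule [set x : M | cmap C r *: x = 0].
Proof.
split; first by apply: mem_set; rewrite /= scaler0.
move=> c u v /set_mem /= ru /set_mem /= rv; apply: mem_set => /=.
rewrite scalerDr rv addr0 scalerA.
have [n [f [fd ->]]] := graded_span (cdeg_graded C) c.
rewrite mulr_sumr scaler_suml big1 // => e _; rewrite (cmap_comm _ (fd e)).
have: (0 < p ^ e)%N by rewrite expn_gt0 prime_gt0 // (pcharf_prime chRp).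
case: (p ^ e)%N => // q _.
by rewrite exprSr rmorphM mulrA -scalerA ru scaler0.
Qed.

Lemma nilrad_fpart r x : r \in @nilrad R -> fpart x -> cmap C r *: x = 0.
Proof.
move=> /asboolP[k rk0] [N _ xN].
have : cplus_pow (maxn k N) x by apply: xN; exact: leq_maxr.
apply: (smallest_sub (submodule_killed r)) => _ [c [m [cP ->]]] /=.
rewrite scalerA cplus_nil ?scale0r //.
have le_k : (k <= p ^ maxn k N)%N.
  apply: (leq_trans (leq_maxl k N)); apply/ltnW/ltn_expl.
  by apply: prime_gt1; apply: pcharf_prime chRp.
by rewrite -(subnK le_k) exprD rk0 mulr0.
Qed.

Definition fpartb (x : M) : bool := x \in fpart.

Lemma fpartb_submod : GRing.submod_closed fpartb.
Proof. exact: submodule_fpart. Qed.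

HB.instance Definition _ := GRing.isSubmodClosed.Build C M fpartb fpartb_submod.

Record fpart_mod : Type := FpartMod { fpart_val : M; _ : fpartb fpart_val }.

HB.instance Definition _ := [isSub of fpart_mod for fpart_val].
HB.instance Definition _ := [Choice of fpart_mod by <:].
HB.instance Definition _ := [SubChoice_isSubLmodule of fpart_mod by <:].

Lemma fpart_mod_killed : killed (@nilrad R : idealr R) fpart_mod.
Proof.
move=> r x rn; apply: val_inj; rewrite linearZ linear0 /=.
by apply: nilrad_fpart => //; apply: set_mem; case: x.
Qed.

End FPurePart.
Arguments cplus_pow {R p chRp C} M n.
Arguments fpart {R p chRp C} M.
Arguments fpart_mod_killed {R p chRp C} M.

Section Spectrum.
Variable R : comNzRingType.

Record spec : Type := Spec {
  spec_set : set R;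
  spec_ideal : idealr_closed [in spec_set];
  spec_prime : prime_idealr_closed [in spec_set]
}.

HB.instance Definition _ := gen_eqMixin spec.
HB.instance Definition _ := gen_choiceMixin spec.

Definition zariski_open (U : set spec) : Prop :=
  exists I : set R, U = [set P : spec | ~ (I `<=` spec_set P)].

Lemma spec1 (P : spec) : ~ spec_set P 1.
Proof. by have [_ /negP h _] := spec_ideal P; move=> /mem_set. Qed.

Lemma specM (P : spec) a u : spec_set P u -> spec_set P (a * u).
Proof.
have [/= P0 _ h] := spec_ideal P => /mem_set Pu; apply: set_mem.
by rewrite -[a * u]addr0; apply: h.
Qed.

Lemma spec_primeM (P : spec) a b :
  spec_set P (a * b) -> spec_set P a \/ spec_set P b.
Proof.
move=> /mem_set ab; have /orP[|] := spec_prime ab; move=> /set_mem; tauto.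
Qed.

Lemma zariski_openT : zariski_open [set: spec].
Proof.
exists setT; apply/seteqP; split=> // P _ /(_ 1 I); exact: spec1.
Qed.

Lemma zariski_openI : setI_closed zariski_open.
Proof.
move=> _ _ [I ->] [J ->]; exists [set x | exists a b, [/\ I a, J b & x = a * b]].
apply/seteqP; split=> P /=.
  move=> [/existsNP[a /not_implyP[Ia Pa]] /existsNP[b /not_implyP[Jb Pb]]] IJ.
  by case: (@spec_primeM P a b) => //; apply: IJ; exists a, b.
move=> IJ; split=> sub; apply: IJ => _ [a [b [Ia Jb ->]]].
  by rewrite mulrC; apply: specM; apply: sub.
by apply: specM; apply: sub.
Qed.

Lemma zariski_open_bigU (K : Type) (U : K -> set spec) :
  (forall k, zariski_open (U k)) -> zariski_open (\bigcup_k U k).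
Proof.
move=> /choice[I IU]; exists (\bigcup_k I k); apply/seteqP; split=> P /=.
  by move=> [k _]; rewrite IU /= => h sub; apply: h => x Ix; apply: sub; exists k.
move=> /existsNP[x /not_implyP[[k _ Ix] Px]]; exists k => //.
by rewrite IU /= => sub; apply: Px; apply: sub.
Qed.

HB.instance Definition _ := isOpenTopological.Build spec
  zariski_openT zariski_openI zariski_open_bigU.

End Spectrum.

Section Irreducible.
Variable T : topologicalType.

Definition irreducible (Z : set T) : Prop := Z !=set0 /\
  forall A B : set T, closed A -> closed B ->
    Z `<=` A `|` B -> Z `<=` A \/ Z `<=` B.

Definition irreducible_component (S Z : set T) : Prop :=
  [/\ Z `<=` S, irreducible Z &
      forall Z', Z' `<=` S -> irreducible Z' -> Z `<=` Z' -> Z' = Z].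

Definition generic_point (Z : set T) (x : T) : Prop :=
  Z x /\ Z `<=` closure [set x].

End Irreducible.

Section TestModule.
Variables (R : comNzRingType) (p : nat) (chRp : p \in [pchar R]).
Variables (C : cartierAlgebra chRp) (M : lmodType C).

(* The fraction m / s in the localization of M at P, as an equivalence class of
   pairs; R acts on M through cmap C. *)
Definition frac (P : spec R) (m : M) (s : R) : set (M * R) :=
  [set y | ~ spec_set P y.2 /\ exists2 t, ~ spec_set P t &
    cmap C t *: (cmap C y.2 *: m - cmap C s *: y.1) = 0].

Definition loc (P : spec R) (N : set M) : set (set (M * R)) :=
  [set z | exists m s, [/\ N m, ~ spec_set P s & z = frac P m s]].

Definition supp (N : set M) : set (spec R) :=
  [set P | loc P N <> [set frac P 0 1]].

Definition generically_fpart (N : set M) : Prop :=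
  forall (Z : set (spec R)) (eta : spec R),
    irreducible_component (supp (fpart M)) Z -> generic_point Z eta ->
    loc eta N = loc eta (fpart M).

Definition is_test_module (T : set M) : Prop :=
  [/\ submodule T, generically_fpart T &
      forall N : set M, submodule N -> generically_fpart N -> T `<=` N].

End TestModule.

Section RingAction.
Variables (R : comNzRingType) (p : nat) (chRp : p \in [pchar R]).

(* A left C-module structure on R inducing the R-module structure of R. *)
Record cartier_action (C : cartierAlgebra chRp) := CartierAction {
  act :> C -> R -> R;
  actA : forall a b x, act a (act b x) = act (a * b) x;
  act1 : left_id 1 act;
  actDr : right_distributive act +%R;
  actDl : forall x, {morph act^~ x : a b / a + b};
  act_cmap : forall r x, act (cmap C r) x = r * x
}.

Definition ring_mod (C : cartierAlgebra chRp) (A : cartier_action C) : Type := R.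

Variables (C : cartierAlgebra chRp) (A : cartier_action C).

HB.instance Definition _ := GRing.Zmodule.on (ring_mod A).
HB.instance Definition _ := GRing.Zmodule_isLmodule.Build C (ring_mod A)
  (actA A) (act1 A) (actDr A) (@actDl _ A).

Lemma ring_mod_cmap r (x : ring_mod A) : cmap C r *: x = r * x :> R.
Proof. exact: act_cmap. Qed.

End RingAction.

Section Reduction.
Variables (R : comNzRingType) (p : nat) (chRp : p \in [pchar R]).
Variables (C : cartierAlgebra chRp).

Definition red_pchar : p \in [pchar redRing R] :=
  quot_pchar chRp (@nilrad R : idealr R).

Definition red_cartier : cartierAlgebra red_pchar :=
  cartier_quot C (@nilrad R : idealr R).

Definition red_fpart (M : lmodType C) : lmodType red_cartier :=
  killed_mod (fpart_mod_killed M).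

Definition red_fpart_incl (M : lmodType C) (x : red_fpart M) : M :=
  fpart_val (x : fpart_mod M).

Lemma red_fpart_incl_inj (M : lmodType C) : injective (@red_fpart_incl M).
Proof. exact: val_inj. Qed.

Lemma red_fpart_incl_range (M : lmodType C) :
  range (@red_fpart_incl M) = fpart M.
Proof.
apply/seteqP; split=> [_ [[x xf] _ <-]|x xf]; first exact: set_mem.
by exists (FpartMod (mem_set xf)).
Qed.

Lemma red_fpart_inclD (M : lmodType C) (x y : red_fpart M) :
  red_fpart_incl (x + y) = red_fpart_incl x + red_fpart_incl y.
Proof. by []. Qed.

Lemma red_fpart_inclZ (M : lmodType C) (c : C) (x : red_fpart M) :
  red_fpart_incl ((cpi (@nilrad R : idealr R) c : red_cartier) *: x) =
    c *: red_fpart_incl x.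
Proof.
by rewrite [_ *: x](killed_scale_pi (fpart_mod_killed M) c x).
Qed.

End Reduction.

(* Main.v *)
(* The chain M_n = C_+^n M stabilizes (Hartshorne-Speiser, Lyubeznik, Gabber).
   The ideals J_n = (M_{n+1} : M_n) increase, so J_n = J for n >= n0; since
   x c = c x^(p^e) for c in C_e, each x in J satisfies x^2 M_{n0} <= M_n for all
   n, i.e. x^2 M_{n0} <= F where F is the intersection of the M_n.  If M_{n0}
   were larger than F, take a prime filtration of M_{n0} / F and a minimal prime
   P among its factors R/P_i.  Localized at P the quotient has finite length, so
   s M_n <= M_{n+1} for some s outside P and some n >= n0, hence s lies in J;
   but x^2 lies in P for every x in J, a contradiction.

   Consequently F is its own F-pure part.  The map Spec R_red -> Spec R is a
   homeomorphism matching supports and localizations, so a C_red-submodule N of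
   F satisfies the generic condition over R_red iff it does over R.  As T and
   its intersection with F agree generically, minimality of T and T' gives both
   inclusions. *)
Require Import Defs.
From mathcomp Require Import all_boot all_order all_algebra.
From mathcomp Require Import all_classical topology.
From mathcomp Require Import ring.
Import GRing.Theory.
Local Open Scope classical_set_scope.
Local Open Scope ring_scope.
Local Open Scope quotient_scope.

Set Implicit Arguments.
Unset Strict Implicit.
Unset Printing Implicit Defensive.

(** * Submodules and the maximal condition *)

Definition maximal_condition (T : Type) (P : set (set T)) : Prop :=
  forall Q : set (set T), Q `<=` P -> Q !=set0 ->
    exists2 X, Q X & forall Y, Q Y -> X `<=` Y -> Y `<=` X.

Lemma submoduleP (S : pzRingType) (M : lmodType S) (N : set M) :
  submodule N <->
  N 0 /\ forall a u v, N u -> N v -> N (a *: u + v).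
Proof.
split=> [[/set_mem N0 NL]|[N0 NL]]; split=> //.
- by move=> a u v /mem_set uN /mem_set vN; apply: set_mem; apply: NL.
- exact: mem_set.
- by move=> a u v /set_mem uN /set_mem vN; apply: mem_set; apply: NL.
Qed.

Lemma mem_span (S : pzRingType) (M : lmodType S) (X : set M) x :
  X x -> Defs.span X x.
Proof. by move=> Xx N [_]; apply. Qed.

Lemma submodule0 (S : pzRingType) (M : lmodType S) (N : set M) :
  submodule N -> N 0.
Proof. by move=> /submoduleP[]. Qed.

Lemma submoduleZ (S : pzRingType) (M : lmodType S) (N : set M) a u :
  submodule N -> N u -> N (a *: u).
Proof. by move=> /submoduleP[N0 NL] uN; rewrite -[_ *: _]addr0; apply: NL. Qed.

Lemma submoduleD (S : pzRingType) (M : lmodType S) (N : set M) u v :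
  submodule N -> N u -> N v -> N (u + v).
Proof.
by move=> /submoduleP[N0 NL] uN vN; rewrite -[u]scale1r; apply: NL.
Qed.

Lemma submodule_sum (S : pzRingType) (M : lmodType S) (N : set M)
    n (f : 'I_n -> M) :
  submodule N -> (forall i, N (f i)) -> N (\sum_i f i).
Proof.
move=> Ns fN; apply: big_ind => //; first exact: submodule0.
by move=> x y; apply: submoduleD.
Qed.

Lemma submodule_bigcup (S : pzRingType) (M : lmodType S) (F : set (set M)) :
  F !=set0 -> total_on F subset -> F `<=` @submodule S M ->
  submodule (\bigcup_(X in F) X).
Proof.
move=> [X0 FX0] Ftot Fsub; apply/submoduleP; split.
  by exists X0 => //; apply: submodule0; apply: Fsub.
move=> a u v [X FX uX] [Y FY vY].
have [XY|YX] := Ftot _ _ FX FY.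
  exists Y => //; have /submoduleP[_] := Fsub _ FY; apply=> //; exact: XY.
by exists X => //; have /submoduleP[_] := Fsub _ FX; apply=> //; exact: YX.
Qed.

Lemma chain_seq (T : eqType) (F : set (set T)) (s : seq T) :
  F !=set0 -> total_on F subset -> {in s, forall x, (\bigcup_(X in F) X) x} ->
  exists2 X, F X & [set` s] `<=` X.
Proof.
move=> F0 Ftot; elim: s => [|x s IHs] sF; first by have [X FX] := F0; exists X.
have [Y FY xY] := sF x (mem_head _ _).
have [|X FX sX] := IHs; first by move=> y ys; apply: sF; rewrite inE ys orbT.
have [XY|YX] := Ftot _ _ FX FY.
  exists Y => // y; rewrite /= inE => /orP[/eqP->//|ys]; apply: XY; exact: sX.
exists X => // y; rewrite /= inE => /orP[/eqP->|ys]; [exact: YX|exact: sX].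
Qed.

(** By Zorn: the union of a nonempty chain of ideals is finitely generated, its generators lie in
    one member of the chain, and so the union is that member. *)
Lemma noetherian_maximal (R : comNzRingType) :
  noetherian R -> maximal_condition (@submodule R R^o).
Proof.
move=> noethR Q Qsub [X0 QX0].
(* [set0] is added because the union of the empty chain must also belong to the family; it is not
   maximal, as [X0] contains 0. *)
have [F FQ Ftot|X [QX Xmax]] := @Zorn_bigcup R^o (Q `|` [set set0]).
  have [[Y [FY QY]]|noY] := pselect (exists Y, F Y /\ Q Y); last first.
    right; apply/seteqP; split=> // x [Y FY xY].
    by have [QY|Y0] := FQ _ FY; [case: noY; exists Y | rewrite Y0 in xY].
  pose G := F `&` Q; have FG : \bigcup_(X in F) X = \bigcup_(X in G) X.
    apply/seteqP; split=> x [Z]; last by move=> [FZ _]; exists Z.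
    move=> FZ xZ; exists Z => //; split=> //.
    by have [//|Z0] := FQ _ FZ; rewrite Z0 in xZ.
  have G0 : G !=set0 by exists Y.
  have Gtot : total_on G subset by move=> A B [FA _] [FB _]; apply: Ftot.
  have Gsub : G `<=` @submodule R R^o by move=> A [_]; apply: Qsub.
  have Usub := submodule_bigcup G0 Gtot Gsub.
  have [s sE] := noethR _ Usub; rewrite FG.
  have [|X GX sX] := @chain_seq R^o G s G0 Gtot.
    by move=> x xs; rewrite sE; apply: mem_span.
  left; suff -> : \bigcup_(X in G) X = X by case: GX.
  apply/seteqP; split=> [|x xX]; last by exists X.
  by rewrite sE; apply: smallest_sub => //; apply: Gsub.
have {}QX : Q X.
  case: QX => // X_0; exfalso; apply: (Xmax X0); last by left.
  rewrite X_0; split=> [x []|X0_sub].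
  exact: X0_sub (submodule0 (Qsub _ QX0)).
exists X => // Y QY XY; apply: contrapT => YX.
by apply: (Xmax Y); [split | left].
Qed.

(** * Colon ideals and the submodules [cplus_pow M n] *)

Section Colon.
Variables (R : comNzRingType) (p : nat) (chRp : p \in [pchar R]).
Variables (C : cartierAlgebra chRp) (M : lmodType C).
Implicit Types (N X : set M) (r x y : R) (m u v : M).

(** Closed under R acting through [cmap] only: the steps of a prime filtration need not be stable
    under C. *)
Definition rsubmodule N : Prop :=
  N 0 /\ forall r u v, N u -> N v -> N (cmap C r *: u + v).

Lemma submodule_rsubmodule N : submodule N -> rsubmodule N.
Proof. by move=> /submoduleP[N0 NL]; split=> // r; apply: NL. Qed.

Lemma rsubmoduleZ N r u : rsubmodule N -> N u -> N (cmap C r *: u).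
Proof. by move=> [N0 NL] uN; rewrite -[_ *: _]addr0; apply: NL. Qed.

Lemma rsubmoduleD N u v : rsubmodule N -> N u -> N v -> N (u + v).
Proof.
by move=> [N0 NL] uN vN; rewrite -[u]scale1r -(rmorph1 (cmap C)); apply: NL.
Qed.

Lemma rsubmoduleB N u v : rsubmodule N -> N u -> N v -> N (u - v).
Proof.
move=> Ns uN vN; rewrite addrC -scaleN1r -(rmorphN1 (cmap C)).
by apply: Ns.2.
Qed.

Lemma cmapA x y m : cmap C x *: (cmap C y *: m) = cmap C (x * y) *: m.
Proof. by rewrite scalerA -rmorphM. Qed.

Lemma cmapZC x y m : cmap C x *: (cmap C y *: m) = cmap C y *: (cmap C x *: m).
Proof. by rewrite !cmapA mulrC. Qed.

Lemma p_prime : prime p.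
Proof. exact: pcharf_prime chRp. Qed.

Lemma leq_pexp e : (0 < p ^ e)%N.
Proof. by rewrite expn_gt0 prime_gt0 ?p_prime. Qed.

Definition colon N X : set R := [set r | forall m, X m -> N (cmap C r *: m)].

Lemma colon_submodule N X : rsubmodule N -> @submodule R R^o (colon N X).
Proof.
move=> Ns; apply/submoduleP; split=> [m _|a u v Nu Nv m Xm].
  by rewrite rmorph0 scale0r; apply: Ns.1.
rewrite rmorphD scalerDl [a *: u]/(a * u) -cmapA.
by apply: Ns.2; [apply: Nu | apply: Nv].
Qed.

(** For c of degree e, r c u = c r^(p^e) u, and r^(p^e) is a multiple of r because p^e > 0. *)
Lemma submodule_annihilated N r :
  submodule N -> submodule [set m | N (cmap C r *: m)].
Proof.
move=> Ns; apply/submoduleP; split=> /= [|c u v ru rv].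
  by rewrite scaler0; apply: (submodule0 Ns).
rewrite scalerDr; apply: (submoduleD Ns) => //; rewrite scalerA.
have [n [f [fd ->]]] := graded_span (cdeg_graded C) c.
rewrite mulr_sumr scaler_suml; apply: (submodule_sum Ns) => e.
rewrite (cmap_comm _ (fd e)) -(prednK (leq_pexp e)) exprSr rmorphM.
by rewrite mulrA -scalerA; apply: submoduleZ.
Qed.

Lemma cplusD (c d : C) : cplus c -> cplus d -> cplus (c + d).
Proof.
move=> [n [f [fd ->]]] [m [g [gd ->]]].
(* Padding with zeros brings both homogeneous decompositions to the common length [maxn n m]. *)
pose h k (q : nat -> C) i := if (i < k)%N then q i else 0.
have hd k q i : (forall j, cdeg C j.+1 (q j)) -> cdeg C i.+1 (h k q i).
  by rewrite /h => qd; case: ifP => // _; apply: cdeg0.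
have hE k (q : nat -> C) l : (k <= l)%N -> 
    \sum_(i < k) q i = \sum_(i < l) h k q i.
  move=> le_kl; rewrite (big_ord_widen l q le_kl) big_mkcond /=.
  by apply: eq_bigr.
exists (maxn n m), (fun i => h n f i + h m g i); split.
  by move=> e; apply: cdegD; apply: hd.
by rewrite big_split /= -!hE ?leq_maxl ?leq_maxr.
Qed.

Lemma cplus_homog e (c : C) : cdeg C e.+1 c -> cplus c.
Proof.
move=> cd; exists e.+1, (fun i => if i == e then c else 0); split.
  by move=> i; case: eqP => [->//|_]; apply: cdeg0.
rewrite big_ord_recr /= eqxx big1 ?add0r // => i _.
by rewrite ltn_eqF.
Qed.

Lemma cplusMr (c a : C) : cplus c -> cplus (c * a).
Proof.
move=> [n [f [fd ->]]].
have [m [g [gd ->]]] := graded_span (cdeg_graded C) a.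
have cplus0 : cplus (0 : C) by apply: (@cplus_homog 0%N); apply: cdeg0.
rewrite mulr_suml; apply: big_ind => // [|i _]; first exact: cplusD.
rewrite mulr_sumr; apply: big_ind => // [|j _]; first exact: cplusD.
apply: (@cplus_homog (i + j)); rewrite -addSn.
exact: (gradedM (cdeg_graded C)).
Qed.

Lemma cplus_pow_submodule n : submodule (cplus_pow M n).
Proof. exact: submodule_span. Qed.

(** The elements sent into C_+^(n+1) M by all of C_+ form a submodule, since C_+ is stable under
    right multiplication by C; hence generators suffice. *)
Lemma cplus_powS n (c : C) m :
  cplus c -> cplus_pow M n m -> cplus_pow M n.+1 (c *: m).
Proof.
move=> cP mn; move: m mn c cP.
have Ns := cplus_pow_submodule n.+1.
suff: cplus_pow M n `<=`
    [set m | forall c : C, cplus c -> cplus_pow M n.+1 (c *: m)] by apply.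
apply: smallest_sub.
  apply/submoduleP; split=> /= [c _|a u v un vn c cP].
    by rewrite scaler0; apply: (submodule0 Ns).
  rewrite scalerDr scalerA; apply: (submoduleD Ns); last exact: vn.
  by apply: un; apply: cplusMr.
move=> _ [d [m [dP ->]]] c cP; apply: mem_span; rewrite scalerA.
(* The tuple with [c] in front of the entries of [d]. *)
exists (fun i => oapp d c (unlift ord0 i)), m; split.
  by move=> i; case: unliftP => [j|] _ /=.
rewrite big_ord_recl unlift_none /=; congr (_ * _ *: _).
by apply: eq_bigr => i _; rewrite liftK.
Qed.

Lemma cplus_pow_gen n N : submodule N ->
  (forall (c : C) m, cplus c -> cplus_pow M n m -> N (c *: m)) ->
  cplus_pow M n.+1 `<=` N.
Proof.
move=> Ns h; apply: smallest_sub => // _ [c [m [cP ->]]].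
rewrite big_ord_recl -scalerA; apply: h => //; apply: mem_span.
by exists (fun i => c (lift ord0 i)), m.
Qed.

Lemma cplus_pow_anti k n : (k <= n)%N -> cplus_pow M n `<=` cplus_pow M k.
Proof.
move=> /subnK <-; elim: (n - k)%N => // {}n IHn; apply: subset_trans IHn.
rewrite addSn; apply: smallest_sub; first exact: cplus_pow_submodule.
(* The last factor is absorbed into the vector, leaving a shorter product. *)
move=> _ [c [x [cP ->]]]; rewrite big_ord_recr -scalerA /=.
apply: mem_span.
by exists (fun i => c (widen_ord (leqnSn _) i)), (c ord_max *: x).
Qed.

Lemma fpart_cplus_pow n : fpart M `<=` cplus_pow M n.
Proof.
move=> x [N _ xN]; apply: (@cplus_pow_anti n (maxn n N)); first exact: leq_maxl.
by apply: xN; apply: leq_maxr.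
Qed.

(* Moving x through an element of positive degree raises it to a power at least
   p, so only the action of x ^+ i for some i <= p is needed on the right. *)
Lemma colon_cplus_powS i x n k : (i <= p)%N ->
  colon (cplus_pow M k) (cplus_pow M n) (x ^+ i) ->
  colon (cplus_pow M k.+1) (cplus_pow M n.+1) x.
Proof.
move=> le_ip xnk m; have Ns := cplus_pow_submodule k.+1.
apply: (cplus_pow_gen (submodule_annihilated x Ns)) => c {}m cP mn /=.
have [l [f [fd ->]]] := cP.
rewrite scaler_suml scaler_sumr; apply: (submodule_sum Ns) => e.
rewrite scalerA (cmap_comm _ (fd e)) -scalerA.
apply: cplus_powS; first exact: cplus_homog (fd e).
have le_i : (i <= p ^ e.+1)%N.
  by rewrite expnS (leq_trans le_ip) // leq_pmulr // leq_pexp.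
rewrite -(subnK le_i) exprD -cmapA.
by apply: (submoduleZ _ (cplus_pow_submodule k)); apply: xnk.
Qed.

End Colon.

(** * Prime filtrations and stabilization of the chain *)

Lemma minimal_in_seq (T : Type) (s : seq (set T)) : s != [::] ->
  exists2 X, X \in s & forall Y, Y \in s -> Y `<=` X -> X `<=` Y.
Proof.
case: s => // Y0 s _; elim: s Y0 => [|Y1 s IHs] Y0.
  by exists Y0; rewrite ?mem_head // => Y; rewrite inE => /eqP->.
have [X Xs Xmin] := IHs Y1.
have [Y0X|Y0X] := pselect (Y0 `<=` X).
  exists Y0; rewrite ?mem_head // => Y; rewrite inE => /orP[/eqP->//|Ys] YY0.
  by apply: subset_trans (Xmin Y Ys _) => //; apply: subset_trans Y0X.
exists X; first by rewrite inE Xs orbT.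
by move=> Y; rewrite inE => /orP[/eqP->//|]; apply: Xmin.
Qed.

Section Stabilization.
Variables (R : comNzRingType) (p : nat) (chRp : p \in [pchar R]).
Variables (C : cartierAlgebra chRp) (M : lmodType C).
Implicit Types (N X F B : set M) (P q : set R) (r x y : R) (m u v z : M).

Definition prime_set P : Prop :=
  [/\ P 0, ~ P 1 & forall x y, P (x * y) -> P x \/ P y].

Definition adjoin X z : set M :=
  [set m | exists u r, X u /\ m = u + cmap C r *: z].

Lemma adjoin_rsubmodule X z : rsubmodule X -> rsubmodule (adjoin X z).
Proof.
move=> Xs; split; first by exists 0, 0; rewrite rmorph0 scale0r addr0; case: Xs.
move=> r _ _ [u [x [Xu ->]]] [v [y [Xv ->]]].
exists (cmap C r *: u + v), (r * x + y); split; first exact: Xs.2.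
by rewrite scalerDr cmapA rmorphD scalerDl addrACA.
Qed.

Lemma sub_adjoin X z : X `<=` adjoin X z.
Proof. by move=> u Xu; exists u, 0; rewrite rmorph0 scale0r addr0. Qed.

Lemma adjoin_gen X z : rsubmodule X -> adjoin X z z.
Proof. by move=> [X0 _]; exists 0, 1; rewrite rmorph1 scale1r add0r. Qed.

(** A chain from F up to the indexed submodule with cyclic factors R/q generated by elements of B;
    the list records the primes q, the topmost factor first. *)
Inductive prime_filtration F B : set M -> seq (set R) -> Prop :=
| FiltNil : prime_filtration F B F [::]
| FiltCons X s z : prime_filtration F B X s -> B z ->
    prime_set (colon X [set z]) ->
    prime_filtration F B (adjoin X z) (colon X [set z] :: s).

Lemma prime_filtration_sub F B X s : rsubmodule F -> rsubmodule B ->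
  F `<=` B -> prime_filtration F B X s ->
  [/\ rsubmodule X, F `<=` X & X `<=` B].
Proof.
move=> Fs Bs FB; elim=> [|{}X {}s z _ [Xs FX XB] Bz _]; first by split.
split; first exact: adjoin_rsubmodule.
  exact: subset_trans FX (@sub_adjoin X z).
move=> _ [u [r [Xu ->]]]; apply: rsubmoduleD => //; first exact: XB.
exact: rsubmoduleZ.
Qed.

(** Each q is a colon (X : z) with z in B and F inside X, so whatever carries B into F lies in q. *)
Lemma prime_filtration_prime F B X s q : rsubmodule F -> rsubmodule B ->
  F `<=` B -> prime_filtration F B X s -> q \in s ->
  prime_set q /\ colon F B `<=` q.
Proof.
move=> Fs Bs FB; elim=> // {}X {}s z Xfilt IH Bz qprime.
rewrite inE => /orP[/eqP->|]; last exact: IH.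
split=> // r rFB _ ->; have [_ FX _] := prime_filtration_sub Fs Bs FB Xfilt.
by apply: FX; apply: rFB.
Qed.

Hypothesis maxR : maximal_condition (@submodule R R^o).
Hypothesis maxM : maximal_condition (@rsubmodule R p chRp C M).

(* A maximal colon ideal (X : z) with z outside X is prime. *)
Lemma prime_colon X B : rsubmodule X -> rsubmodule B -> ~ (B `<=` X) ->
  exists z, [/\ B z, ~ X z & prime_set (colon X [set z])].
Proof.
move=> Xs Bs BX.
pose Q : set (set R^o) :=
  [set I | exists z, [/\ B z, ~ X z & I = colon X [set z]]].
have [||I [z [Bz Xz ->]] Imax] := @maxR Q.
- by move=> _ [z [_ _ ->]]; apply: colon_submodule.
- move: BX => /existsNP[z /not_implyP[Bz Xz]].
  by exists (colon X [set z]), z.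
exists z; split=> //; split.
- by move=> _ ->; rewrite rmorph0 scale0r; apply: Xs.1.
- by move=> /(_ z erefl); rewrite rmorph1 scale1r.
move=> x y xyX; apply: contrapT => /not_orP[xX yX]; apply: xX => _ ->.
(* If y is not in (X : z), then (X : yz) is a member of the family containing (X : z), so it equals
   it by maximality; it contains x. *)
apply: (Imax (colon X [set cmap C y *: z])) => //.
- exists (cmap C y *: z); split=> //; first exact: rsubmoduleZ.
  by apply: contra_not yX => yX _ ->.
- by move=> r rX _ ->; rewrite cmapZC; apply: rsubmoduleZ => //; apply: rX.
by move=> _ ->; rewrite cmapA; apply: xyX.
Qed.

(** A maximal submodule reached by a filtration must be B: otherwise [prime_colon] provides one more
    factor. *)
Lemma prime_filtration_exists F B : rsubmodule F -> rsubmodule B ->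
  F `<=` B -> exists s, prime_filtration F B B s.
Proof.
move=> Fs Bs FB.
have filtP := prime_filtration_sub Fs Bs FB.
have [||X [s Xfilt] Xmax] := @maxM [set X | exists s, prime_filtration F B X s].
- by move=> X [s] /filtP[].
- by exists F, [::]; apply: FiltNil.
have [Xs FX XB] := filtP _ _ Xfilt.
exists s; suff XBE : X = B by rewrite -{2}XBE.
apply/seteqP; split=> //; apply: contrapT => /(prime_colon Xs Bs).
move=> [z [Bz Xz zprime]]; apply: Xz.
apply: (Xmax (adjoin X z)); last exact: adjoin_gen.
  by exists (colon X [set z] :: s); apply: FiltCons.
exact: sub_adjoin.
Qed.

(** For a descending N: after localization at P, the traces of the [N e] on X are constant from [e0]
    on. The denominator may depend on the element and on e. *)
Definition locally_stable P (N : nat -> set M) X : Prop :=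
  exists e0, forall e m, (e0 <= e)%N -> X m -> N e0 m ->
    exists2 s, ~ P s & N e (cmap C s *: m).

(* Only the factors R/P of the filtration survive localization at P, and modulo
   such a factor a descending chain of ideals containing P either stays in P or
   always meets the complement of P. *)
Lemma prime_filtration_stable F B P X s (N : nat -> set M) :
  rsubmodule F -> rsubmodule B -> F `<=` B ->
  (forall e, rsubmodule (N e)) ->
  (forall e e', (e <= e')%N -> N e' `<=` N e) ->
  (forall e, F `<=` N e) ->
  prime_set P -> (forall q, q \in s -> q `<=` P -> P `<=` q) ->
  prime_filtration F B X s -> locally_stable P N X.
Proof.
move=> Fs Bs FB Ns Nanti FN [P0 P1 PM] Pmin Xfilt.
have PM' x y : ~ P x -> ~ P y -> ~ P (x * y) by move=> Px Py /PM[].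
elim: Xfilt Pmin => [|{}X {}s z Xfilt IH Bz _] Pmin.
  exists 0%N => e m _ Fm _; exists 1 => //.
  by rewrite rmorph1 scale1r; apply: FN.
have [Xs _ _] := prime_filtration_sub Fs Bs FB Xfilt.
have [|e0 e0P] := IH; first by move=> q qs; apply: Pmin; rewrite inE qs orbT.
pose q := colon X [set z].
have [qP|/existsNP[t /not_implyP[qt Pt]]] := pselect (q `<=` P); last first.
  (* The element t of q outside P carries m into X, so the factor R/q vanishes at P and the
     induction hypothesis applies to t m. *)
  exists e0 => e m le_e [u [r [Xu mE]]] Nm.
  have [|||s' Ps' Ns'] := e0P e (cmap C t *: m) => //.
  - rewrite mE scalerDr; apply: rsubmoduleD => //; first exact: rsubmoduleZ.
    by rewrite cmapZC; apply: rsubmoduleZ => //; apply: qt.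
  - exact: rsubmoduleZ.
  by exists (s' * t); [exact: PM' | rewrite -cmapA].
have Pq : P `<=` q by apply: Pmin => //; apply: mem_head.
(* Now q = P. Either from some [e1] on the coefficients of z all lie in q, which puts the elements
   of [N e] into X, or every [N e] has an element with coefficient outside P. *)
have [[e1 e1P]|noe1] := pselect (exists e1, forall u r, X u ->
    N e1 (u + cmap C r *: z) -> P r).
  exists (maxn e0 e1) => e m le_e [u [r [Xu mE]]] Nm; apply: e0P.
  - exact: leq_trans (leq_maxl _ _) le_e.
  - rewrite mE; apply: rsubmoduleD => //; apply: (Pq r _ z) => //.
    by apply: (e1P u) => //; rewrite -mE; apply: Nanti Nm; apply: leq_maxr.
  - by apply: Nanti Nm; apply: leq_maxl.
exists e0 => e m le_e [u [r [Xu mE]]] Nm.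
have [u' [r' [Xu' Nm' Pr']]] : exists u' r',
    [/\ X u', N e (u' + cmap C r' *: z) & ~ P r'].
  apply: contrapT => no; apply: noe1; exists e => u' r' Xu' Nu'.
  by apply: contrapT => Pr'; apply: no; exists u', r'.
(* In r' m - r m' the multiples of z cancel, which leaves an element of X. As m' already lies in
   [N e], it can be added back, and r' outside P joins the denominator. *)
pose m' := u' + cmap C r' *: z.
have mm'E : cmap C r' *: m - cmap C r *: m' = cmap C r' *: u - cmap C r *: u'.
  by rewrite mE /m' !scalerDr (cmapZC r' r) opprD addrACA subrr addr0.
have [|||s' Ps' Ns'] := e0P e (cmap C r' *: m - cmap C r *: m') => //.
- by rewrite mm'E; apply: rsubmoduleB => //; apply: rsubmoduleZ.
- by apply: rsubmoduleB => //; apply: rsubmoduleZ => //; apply: Nanti Nm'.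
exists (s' * r'); first exact: PM'.
rewrite -cmapA -[cmap C r' *: m](subrK (cmap C r *: m')) scalerDr.
by apply: rsubmoduleD => //; do 2 apply: rsubmoduleZ => //.
Qed.

(** The submodules [L s] of elements of X that s carries into N are directed, since [L (s * t)]
    contains both [L s] and [L t]; a maximal one is therefore all of X. *)
Lemma uniform_denominator P N X : rsubmodule N -> rsubmodule X ->
  prime_set P ->
  (forall m, X m -> exists2 s, ~ P s & N (cmap C s *: m)) ->
  exists2 s, ~ P s & forall m, X m -> N (cmap C s *: m).
Proof.
move=> Ns Xs [P0 P1 PM] XN.
pose L s := [set m | X m /\ N (cmap C s *: m)].
have [||_ [s Ps <-] Lmax] := @maxM (L @` ~` P).
- move=> _ [s _ <-]; split.
    by rewrite /L /= scaler0; split; [apply: Xs.1 | apply: Ns.1].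
  move=> r u v [Xu Nu] [Xv Nv]; split; first exact: Xs.2.
  by rewrite scalerDr cmapZC; apply: Ns.2.
- by exists (L 1), 1.
exists s => // m Xm; have [t Pt Nt] := XN m Xm.
suff [] : L s m by []; apply: (Lmax (L (s * t))).
- by exists (s * t) => // /PM[].
- by move=> u [Xu Nu]; split=> //; rewrite mulrC -cmapA; apply: rsubmoduleZ.
by split=> //; rewrite -cmapA; apply: rsubmoduleZ.
Qed.

Lemma cplus_pow_stable : exists n0,
  forall n, (n0 <= n)%N -> cplus_pow M n = cplus_pow M n0.
Proof.
pose N n : set M := cplus_pow M n.
have Ns n : rsubmodule (N n) by apply/submodule_rsubmodule/cplus_pow_submodule.
have Fs : rsubmodule (fpart M) by apply/submodule_rsubmodule/submodule_fpart.
have FN n : fpart M `<=` N n by apply: fpart_cplus_pow.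
pose J n := colon (N n.+1) (N n).
have JS n : J n `<=` J n.+1.
  move=> x xJ; apply: (@colon_cplus_powS _ _ _ _ _ 1) => //.
  exact: prime_gt0 (p_prime chRp).
have Jmono a b : (a <= b)%N -> J a `<=` J b.
  by move=> /subnK <-; elim: (b - a)%N => // k IHk; apply: subset_trans (JS _).
have [||_ [n0 _ <-] J0max] := @maxR (range J).
- by move=> _ [n _ <-]; apply: colon_submodule.
- by exists (J 0%N), 0%N.
have JE n x : (n0 <= n)%N -> J n x -> J n0 x.
  by move=> le_n; apply: J0max; [exists n | apply: Jmono].
exists n0 => n le_n; apply/seteqP; split; first exact: cplus_pow_anti.
suff NF : N n0 `<=` fpart M by apply: subset_trans NF (FN n).
have sqrJ k n1 x : (n0 <= n1)%N -> J n0 x ->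
    colon (N (n1 + k)%N) (N n1) (x ^+ 2).
  elim: k n1 => [|k IHk] n1 le_n1 xJ m Nm.
    by rewrite addn0; apply: (rsubmoduleZ _ (Ns n1)).
  (* One factor x moves m into [N n1.+1]; the other moves the result into [N (n1 + k).+1], by the
     induction hypothesis on x^2 and 2 <= p. *)
  rewrite addnS expr2 -cmapA; apply: (@colon_cplus_powS _ _ _ _ _ 2 x n1) => //.
  - exact: prime_gt1 (p_prime chRp).
  - exact: IHk.
  exact: (Jmono _ _ le_n1 _ xJ).
have JF x : J n0 x -> colon (fpart M) (N n0) (x ^+ 2).
  move=> xJ m Nm; exists n0 => // k /= le_k.
  by rewrite -(subnKC le_k); apply: sqrJ.
have [s filt] := prime_filtration_exists Fs (Ns n0) (FN n0).
(* A filtration without factors means that [N n0] is already [fpart M]. *)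
case: s filt => [|q0 s] filt.
  by inversion filt.
have [//|P Ps Pmin] := @minimal_in_seq _ (q0 :: s).
have [Pprime FBP] := prime_filtration_prime Fs (Ns n0) (FN n0) filt Ps.
have [e0 e0P] : locally_stable P (fun e => N (n0 + e)%N) (N n0).
  apply: (prime_filtration_stable Fs (Ns n0) (FN n0)) filt => //.
  by move=> e e' le_e; apply: cplus_pow_anti; rewrite leq_add2l.
have [|t Pt tJ] := @uniform_denominator P (N (n0 + e0).+1) (N (n0 + e0)%N)
    (Ns _) (Ns _) Pprime.
  move=> m Nm; rewrite -addnS; apply: e0P => //.
  by apply: cplus_pow_anti Nm; apply: leq_addr.
exfalso; apply: Pt; have [P0 P1 PM] := Pprime.
have tJ0 : J n0 t by apply: (JE (n0 + e0)%N) => //; apply: leq_addr.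
have : P (t ^+ 2) by apply/FBP/JF.
by rewrite expr2 => /PM[].
Qed.

End Stabilization.

(** * Irreducible components and generic points under a homeomorphism *)

Section Homeomorphism.
Variables (X Y : topologicalType) (f : X -> Y) (g : Y -> X).
Hypotheses (f_cont : continuous f) (g_cont : continuous g).
Hypotheses (fK : cancel f g) (gK : cancel g f).

Lemma irreducible_image (U V : topologicalType) (h : U -> V) (Z : set U) :
  continuous h -> irreducible Z -> irreducible (h @` Z).
Proof.
move=> h_cont [[z Zz] Zirr]; split; first by exists (h z), z.
move=> A B Acl Bcl ZAB.
have cl D : closed D -> closed (h @^-1` D) by apply: preimage_closed.
have [|ZA|ZB] := Zirr _ _ (cl _ Acl) (cl _ Bcl).
- by move=> x Zx; apply: ZAB; exists x.
- by left=> _ [x Zx <-]; apply: ZA.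
- by right=> _ [x Zx <-]; apply: ZB.
Qed.

Lemma irreducible_component_image (S Z : set X) :
  irreducible_component S Z -> irreducible_component (f @` S) (f @` Z).
Proof.
move=> [ZS Zirr Zmax]; split; first exact: image_subset.
  exact: irreducible_image.
move=> Z' Z'S Z'irr ZZ'.
have gZ' : g @` Z' = Z.
  apply: Zmax; last by move=> x Zx; exists (f x) => //; apply: ZZ'; exists x.
    by move=> _ [y Z'y <-]; have [x Sx <-] := Z'S y Z'y; rewrite fK.
  exact: irreducible_image.
rewrite -gZ'; apply/seteqP; split=> [y Z'y|_ [_ [y Z'y <-] <-]].
  by exists (g y) => //; exists y.
by rewrite gK.
Qed.

Lemma generic_point_image (Z : set X) (x : X) :
  generic_point Z x -> generic_point (f @` Z) (f x).
Proof.
move=> [Zx Zcl]; split; first by exists x.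
move=> _ [z Zz <-] B /f_cont /(Zcl _ Zz)[_ [-> Bfx]].
by exists (f x).
Qed.

End Homeomorphism.

(** * The homeomorphism between Spec R and Spec R_red *)

Lemma spec_eq (R : comNzRingType) (P Q : spec R) :
  spec_set P = spec_set Q -> P = Q.
Proof.
case: P Q => [P Pi Pp] [Q Qi Qp] /= PQ; subst Q.
by congr Spec; apply: Prop_irrelevance.
Qed.

Section Comap.
Variables (R S : comNzRingType) (f : {rmorphism R -> S}).

Lemma comap_ideal (Q : spec S) : idealr_closed [in f @^-1` spec_set Q].
Proof.
have [/set_mem Q0 _ QL] := spec_ideal Q; split.
- by apply: mem_set; rewrite /= rmorph0.
- by apply/negP => /set_mem /=; rewrite rmorph1; apply: spec1.
move=> a u v /set_mem /= Qu /set_mem /= Qv; apply: mem_set => /=.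
rewrite rmorphD rmorphM; apply: set_mem.
by apply: QL; apply: mem_set.
Qed.

Lemma comap_prime (Q : spec S) : prime_idealr_closed [in f @^-1` spec_set Q].
Proof.
move=> u v /set_mem /=; rewrite rmorphM => /spec_primeM[Qu|Qv].
  by apply/orP; left; apply: mem_set.
by apply/orP; right; apply: mem_set.
Qed.

Definition spec_comap (Q : spec S) : spec R :=
  Spec (comap_ideal Q) (@comap_prime Q).

Lemma spec_comap_continuous : continuous spec_comap.
Proof.
apply/continuousP => _ [I ->]; exists (f @` I).
apply/seteqP; split=> Q /= IQ sub; apply: IQ.
  by move=> r Ir; apply: sub; exists r.
by move=> _ [r Ir <-]; apply: sub.
Qed.

End Comap.

Section Reduction.
Variable R : comNzRingType.
Local Notation nil := (@nilrad R : idealr R).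

Definition redpi : {rmorphism R -> redRing R} := \pi_{ideal_quot nil}.

Lemma redpi_surj (x : redRing R) : exists r, redpi r = x.
Proof. by exists (repr (x : {ideal_quot nil})); apply: reprK. Qed.

Lemma redpi_eq x y : redpi x = redpi y -> x - y \in @nilrad R.
Proof.
move=> xy; have: redpi x == redpi y by apply/eqP.
by rewrite -Quotient.idealrBE.
Qed.

Lemma nilrad_spec (P : spec R) r : r \in @nilrad R -> spec_set P r.
Proof.
move=> /asboolP[n rn0].
have : spec_set P (r ^+ n) by rewrite rn0; have [/set_mem] := spec_ideal P.
elim: n {rn0} => [|n IHn]; first by rewrite expr0 => /spec1.
by rewrite exprS => /spec_primeM[].
Qed.

Definition spec_red_set (P : spec R) : set (redRing R) := redpi @` spec_set P.

(** A prime contains the nilradical, so membership in it depends only on the class of r. *)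
Lemma spec_red_setE (P : spec R) r : spec_red_set P (redpi r) <-> spec_set P r.
Proof.
split=> [[s Ps /redpi_eq sr]|]; last by exists r.
have [_ _ PL] := spec_ideal P.
rewrite -[r](subKr s) addrC -mulN1r; apply: set_mem.
by apply: PL; apply: mem_set => //; apply: nilrad_spec.
Qed.

Lemma spec_red_ideal (P : spec R) : idealr_closed [in spec_red_set P].
Proof.
have [/set_mem P0 _ PL] := spec_ideal P; split.
- by apply: mem_set; rewrite -(rmorph0 redpi); apply/spec_red_setE.
- apply/negP => /set_mem; rewrite -(rmorph1 redpi) => /spec_red_setE.
  exact: spec1.
move=> a _ _ /set_mem[u Pu <-] /set_mem[v Pv <-]; apply: mem_set.
have [b <-] := redpi_surj a; rewrite -rmorphM -rmorphD; apply/spec_red_setE.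
by apply: set_mem; apply: PL; apply: mem_set.
Qed.

Lemma spec_red_prime (P : spec R) : prime_idealr_closed [in spec_red_set P].
Proof.
move=> x y; have [u <-] := redpi_surj x; have [v <-] := redpi_surj y.
rewrite -rmorphM => /set_mem/spec_red_setE/spec_primeM[Pu|Pv].
  by apply/orP; left; apply/mem_set/spec_red_setE.
by apply/orP; right; apply/mem_set/spec_red_setE.
Qed.

Definition spec_red (P : spec R) : spec (redRing R) :=
  Spec (spec_red_ideal P) (@spec_red_prime P).

Lemma spec_red_continuous : continuous spec_red.
Proof.
apply/continuousP => _ [I ->]; exists (redpi @^-1` I).
apply/seteqP; split=> P /= IP sub; apply: IP.
  by move=> x; have [r <-] := redpi_surj x => Ir; apply/spec_red_setE/sub.
by move=> r /sub/spec_red_setE.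
Qed.

Lemma spec_comapK : cancel (spec_comap redpi) spec_red.
Proof.
move=> Q; apply: spec_eq; apply/seteqP; split=> /= [_ [r Qr <-] //|x].
by have [r <-] := redpi_surj x => Qr; exists r.
Qed.

Lemma spec_redK : cancel spec_red (spec_comap redpi).
Proof.
by move=> P; apply: spec_eq; apply/seteqP; split=> r /spec_red_setE.
Qed.

End Reduction.

(** * Fractions and localized submodules *)

Section Localization.
Variables (R : comNzRingType) (p : nat) (chRp : p \in [pchar R]).
Variables (C : cartierAlgebra chRp) (M : lmodType C).
Implicit Types (N : set M) (P : spec R).

Lemma spec_notM P x y :
  ~ spec_set P x -> ~ spec_set P y -> ~ spec_set P (x * y).
Proof. by move=> Px Py /spec_primeM[]. Qed.

Definition frac_eqv P (a b : M * R) : Prop :=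
  exists2 r, ~ spec_set P r & cmap C (r * b.2) *: a.1 = cmap C (r * a.2) *: b.1.

Lemma frac_eqv_sym P a b : frac_eqv P a b -> frac_eqv P b a.
Proof. by move=> [r Pr rab]; exists r. Qed.

Lemma frac_eqv_trans P a b c : ~ spec_set P b.2 ->
  frac_eqv P a b -> frac_eqv P b c -> frac_eqv P a c.
Proof.
move=> Pb [r Pr rab] [s Ps sbc]; exists (r * s * b.2).
  by do 2 apply: spec_notM => //.
have -> : r * s * b.2 * c.2 = s * c.2 * (r * b.2) by ring.
rewrite -cmapA rab cmapA.
have -> : s * c.2 * (r * a.2) = r * a.2 * (s * c.2) by ring.
by rewrite -cmapA sbc cmapA; congr (cmap C _ *: _); ring.
Qed.

Lemma fracE P m s a :
  Defs.frac P m s a <-> ~ spec_set P a.2 /\ frac_eqv P (m, s) a.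
Proof.
split=> -[Pa [t Pt ta]]; split=> //; exists t => //=.
  by apply/eqP; rewrite -subr_eq0 -!cmapA -scalerBr ta.
by rewrite scalerBr !cmapA ta subrr.
Qed.

Lemma frac_eqP P m n s t : ~ spec_set P s -> ~ spec_set P t ->
  Defs.frac P m s = Defs.frac P n t <-> frac_eqv P (m, s) (n, t).
Proof.
move=> Ps Pt; split=> [mn|mn].
  have : Defs.frac P n t (n, t).
    by apply/fracE; split=> //; exists 1 => //; apply: spec1.
  by rewrite -mn => /fracE[].
apply/seteqP; split=> a /fracE[Pa sa]; apply/fracE; split=> //.
  by apply: frac_eqv_trans sa => //; apply: frac_eqv_sym.
exact: frac_eqv_trans sa.
Qed.

(** Replaces classes of fractions by clearing denominators, the form in which localizations are
    compared from here on. *)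
Lemma loc_subP P N N' : rsubmodule N -> rsubmodule N' ->
  loc P N `<=` loc P N' <->
  forall m, N m -> exists2 t, ~ spec_set P t & N' (cmap C t *: m).
Proof.
move=> Ns N's; split=> [NN' m Nm|NN' _ [m [s [Nm Ps ->]]]].
  have /NN'[n [s [N'n Ps /frac_eqP[||t Pt /= tmn]]]] :
      loc P N (Defs.frac P m 1).
  - by exists m, 1; split=> //; apply: spec1.
  - exact: spec1.
  - by [].
  exists (t * s); first exact: spec_notM.
  by rewrite tmn; apply: rsubmoduleZ.
have [t Pt N't] := NN' m Nm; exists (cmap C t *: m), (t * s).
split=> //; first exact: spec_notM.
apply/frac_eqP => //; first exact: spec_notM.
by exists 1; [exact: spec1 | rewrite cmapA /= !mul1r mulrC].
Qed.

Lemma loc_eqP P N N' : rsubmodule N -> rsubmodule N' -> loc P N = loc P N' <->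
  (forall m, N m -> exists2 t, ~ spec_set P t & N' (cmap C t *: m)) /\
  (forall m, N' m -> exists2 t, ~ spec_set P t & N (cmap C t *: m)).
Proof.
move=> Ns N's; split=> [NN'|[/loc_subP NN' /loc_subP N'N]].
  by split; apply/loc_subP => //; rewrite NN'.
by apply/seteqP; split; [apply: NN' | apply: N'N].
Qed.

(** Turns membership in the support into an inequality of two localizations, so that results on
    [loc] apply to [supp]. *)
Lemma loc0 P : loc P [set 0 : M] = [set Defs.frac P 0 1].
Proof.
apply/seteqP; split=> [_ [_ [s [-> Ps ->]]]|_ ->]; last first.
  by exists 0, 1; split=> //; apply: spec1.
apply/frac_eqP => //; first exact: spec1.
by exists 1; [exact: spec1 | rewrite !scaler0].
Qed.

End Localization.

(** * The F-pure part as a module over C_red *)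

Section RedModule.
Variables (R : comNzRingType) (p : nat) (chRp : p \in [pchar R]).
Variables (C : cartierAlgebra chRp) (M : lmodType C).
Implicit Types (N : set (red_fpart M)) (Q : spec (redRing R)).
Local Notation cp c := (cpi (@nilrad R : idealr R) c : red_cartier C).
Local Notation incl := (@red_fpart_incl R p chRp C M).
Local Notation down := (spec_comap (redpi R)).

Lemma red_cmap r (x : red_fpart M) :
  incl (cmap (red_cartier C) (redpi R r) *: x) = cmap C r *: incl x.
Proof. by rewrite -red_fpart_inclZ -cquot_map_pi. Qed.

Lemma red_fpart_val x : fpart M (incl x).
Proof. by rewrite -red_fpart_incl_range; exists x. Qed.

Lemma image_incl_submodule N : submodule N -> submodule (incl @` N).
Proof.
move=> Ns; apply/submoduleP; split; first by exists 0 => //; apply: submodule0.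
move=> c _ _ [x Nx <-] [y Ny <-]; exists (cp c *: x + y).
  by have /submoduleP[_] := Ns; apply.
by rewrite red_fpart_inclD red_fpart_inclZ.
Qed.

Lemma preimage_incl_submodule (X : set M) :
  submodule X -> submodule (incl @^-1` X).
Proof.
move=> Xs; apply/submoduleP; split=> [|c x y Xx Xy].
  exact: (submodule0 Xs).
suff : X (incl (c *: x + y)) by [].
rewrite red_fpart_inclD -[c](creprK c) red_fpart_inclZ.
by have /submoduleP[_] := Xs; apply.
Qed.

Lemma cplus_cpi (c : C) : cplus c -> cplus (cp c).
Proof.
move=> [n [f [fd ->]]]; exists n, (fun e => cp (f e)); split.
  by move=> e; exists (f e).
by rewrite raddf_sum.
Qed.

(** F is C_+^(n+n0) M. In each generating product the last n0 factors send M into F, and the first n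
    act on F through C_red; so F = C_+^n F for every n. *)
Lemma fpart_red_fpart n0 :
  (forall n, (n0 <= n)%N -> cplus_pow M n = cplus_pow M n0) ->
  fpart (red_fpart M) = setT.
Proof.
move=> stab; have FE := fpartE stab.
apply/seteqP; split=> // x _; exists 0%N => // n _ /=.
suff : (incl @` cplus_pow (red_fpart M) n) (incl x).
  by move=> [y ny /red_fpart_incl_inj <-].
have := red_fpart_val x; rewrite FE -(stab (n + n0)%N) ?leq_addl //.
move: (incl x); apply: smallest_sub.
  by apply: image_incl_submodule; apply: cplus_pow_submodule.
move=> _ [c [m [cP ->]]]; rewrite big_split_ord -scalerA /=.
set m' := _ *: m; have : fpart M m'.
  by rewrite FE; apply: mem_span; exists (fun i => c (rshift n i)), m.
rewrite -red_fpart_incl_range => -[y _ <-].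
exists (cp (\prod_(i < n) c (lshift n0 i)) *: y); last exact: red_fpart_inclZ.
apply: mem_span; exists (fun i => cp (c (lshift n0 i))), y; split.
  by move=> i; apply: cplus_cpi.
by congr (_ *: _); apply: (rmorph_prod (cpi (@nilrad R : idealr R))).
Qed.

(** Every element of R_red is some [redpi R r], which avoids Q exactly when r avoids the preimage of
    Q; both sides thus clear the same denominators. *)
Lemma loc_red Q N N' : submodule N -> submodule N' ->
  loc Q N = loc Q N' <-> loc (down Q) (incl @` N) = loc (down Q) (incl @` N').
Proof.
have half (X X' : set (red_fpart M)) :
    (forall x, X x -> exists2 t, ~ spec_set Q t & X' (cmap _ t *: x)) <->
    (forall m, (incl @` X) m -> exists2 t, ~ spec_set (down Q) t &
       (incl @` X') (cmap C t *: m)).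
  split=> [XX' _ [x Xx <-]|XX' x Xx].
    have [t] := XX' x Xx; have [r <-] := redpi_surj t => Qr X'r.
    exists r => //; exists (cmap (red_cartier C) (redpi R r) *: x) => //.
    exact: red_cmap.
  have [|r Qr [y X'y yE]] := XX' (incl x); first by exists x.
  exists (redpi R r) => //.
  suff <- : y = cmap (red_cartier C) (redpi R r) *: x by [].
  by apply: red_fpart_incl_inj; rewrite red_cmap.
move=> Ns N's.
have [Nr N'r] := (submodule_rsubmodule Ns, submodule_rsubmodule N's).
have iNr := submodule_rsubmodule (image_incl_submodule Ns).
have iN'r := submodule_rsubmodule (image_incl_submodule N's).
split=> /loc_eqP[] // NN' N'N; apply/loc_eqP => //; split.
- exact/half.
- exact/half.
- exact/half.
- exact/half.
Qed.

Lemma supp_red Q N : submodule N ->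
  supp N Q <-> supp (incl @` N) (down Q).
Proof.
move=> Ns; have zero_sub : submodule [set 0 : red_fpart M].
  by apply/submoduleP; split=> // c _ _ -> ->; rewrite scaler0 addr0.
have := loc_red Q Ns zero_sub.
rewrite image_set1 !loc0 => locE.
by split; apply: contra_not => /locE.
Qed.

Lemma supp_fpart_red : supp [set: red_fpart M] =
  spec_red (R := R) @` supp (fpart M).
Proof.
have M's : submodule [set: red_fpart M] by apply/submoduleP.
apply/seteqP; split=> [Q /(supp_red Q M's)|_ [P FP <-]].
  rewrite red_fpart_incl_range => FQ.
  by exists (down Q) => //; apply: spec_comapK.
by apply/supp_red => //; rewrite red_fpart_incl_range spec_redK.
Qed.

(** Since F is its own F-pure part, both conditions compare N with F itself, at generic points
    matched by the homeomorphism. *)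
Lemma generically_fpart_red N : submodule N -> fpart (red_fpart M) = setT ->
  generically_fpart N <-> generically_fpart (incl @` N).
Proof.
move=> Ns Fpure; have M's : submodule [set: red_fpart M] by apply/submoduleP.
rewrite /generically_fpart Fpure -(red_fpart_incl_range M) supp_fpart_red.
have down_cont := @spec_comap_continuous _ _ (redpi R).
have red_cont := @spec_red_continuous R.
have downK := @spec_comapK R; have redK := @spec_redK R.
split=> gen Z eta Zcomp Zeta.
  rewrite -(redK eta); apply/loc_red => //.
  apply: (gen (spec_red (R := R) @` Z)); last exact: generic_point_image.
  rewrite -(red_fpart_incl_range M); apply: irreducible_component_image => //.
apply/loc_red => //; apply: (gen (down @` Z)); last exact: generic_point_image.
(* Written as an image under [down], the support fits the transfer of components in the reverse
   direction. *)
have -> : supp (range incl) = down @` (spec_red (R := R) @` supp (fpart M)).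
  rewrite red_fpart_incl_range; apply/seteqP; split=> [P FP|_ [_ [P FP <-] <-]].
    by exists (spec_red P) => //; exists P.
  by rewrite redK.
exact: irreducible_component_image.
Qed.

Lemma test_module_red (T : set M) (T' : set (red_fpart M)) :
  fpart (red_fpart M) = setT -> is_test_module T -> is_test_module T' ->
  T = incl @` T'.
Proof.
move=> Fpure [Ts Tgen Tmin] [T's T'gen T'min].
have Fr := submodule_rsubmodule (submodule_fpart M).
have Tr := submodule_rsubmodule Ts.
apply/seteqP; split.
  by apply: Tmin; [exact: image_incl_submodule | exact/generically_fpart_red].
pose N := incl @^-1` T; have Ns : submodule N by apply: preimage_incl_submodule.
suff T'N : T' `<=` N by move=> _ [x T'x <-]; apply: T'N.
apply: T'min => //; apply/generically_fpart_red => // Z eta Zcomp Zeta.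
have [TF FT] := (loc_eqP eta Tr Fr).1 (Tgen Z eta Zcomp Zeta).
have Nr := submodule_rsubmodule (image_incl_submodule Ns).
apply/loc_eqP => //; split=> [_ [x Tx <-]|m Fm].
  exists 1; first exact: spec1.
  by rewrite rmorph1 scale1r; apply: red_fpart_val.
(* The multiple t m lies in T by the choice of t and in F because F is a submodule, hence in the
   image of N. *)
have [t Pt Tt] := FT m Fm; exists t => //.
have : fpart M (cmap C t *: m) by apply: rsubmoduleZ.
rewrite -red_fpart_incl_range => -[x _ xE]; exists x => //.
by rewrite /N /= xE.
Qed.

End RedModule.

(** * The module M = R over a Noetherian ring *)

Unset Implicit Arguments.

Theorem theorem3p17 (p : nat) (R : comNzRingType) (chRp : p \in [pchar R])
    (C : cartierAlgebra chRp) (A : cartier_action C)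
    (T : set (ring_mod A)) (T' : set (red_fpart (ring_mod A))) :
  noetherian R ->
  is_test_module T ->
  is_test_module T' ->
  T = [set red_fpart_incl x | x in T'].
Proof.
move=> /noetherian_maximal maxR testT testT'.
have [|n0 stab] := @cplus_pow_stable _ _ _ C (ring_mod A) maxR.
  (* On [ring_mod A] the action through [cmap] is multiplication in R, so R-submodules are
     ideals. *)
  move=> Q Qsub; apply: maxR => N /Qsub[N0 NL].
  apply/submoduleP; split=> // a u v Nu Nv.
  by have := NL a u v Nu Nv; rewrite ring_mod_cmap.
apply: test_module_red => //; exact: fpart_red_fpart stab.
Qed.
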